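(* Let $A,B$ be $n\times n$ complex positive semidefinite matrices. Then, for all $k=1,\dots,n$, $$ \prod_{j=1}^k\lambda_j^\uparrow\big(\sqrt{|AB|}\big)\le\prod_{j=1}^k\lambda_j^\uparrow\left(\frac{A+B}{2}\right). $$
   Context: For a complex matrix $X$, $|X|=(X^*X)^{1/2}$, and $\sqrt{\cdot}$ denotes the positive semidefinite square root. For a Hermitian matrix $H$, $\lambda_1^\uparrow(H)\le\lambda_2^\uparrow(H)\le\dots\le\lambda_n^\uparrow(H)$ are its eigenvalues, with multiplicity, in increasing order. *)

(* Defs.v *)
From HB Require Import structures.
From mathcomp Require Import all_boot all_order all_algebra.
From mathcomp Require Import sesquilinear spectral.
From mathcomp Require Import complex.
From mathcomp Require Import reals.

Set Implicit Arguments.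
Unset Strict Implicit.
Unset Printing Implicit Defensive.

Import Order.TTheory GRing.Theory Num.Theory.
Local Open Scope ring_scope.
Local Open Scope complex_scope.
Local Open Scope sesquilinear_scope.

Definition psdmx (C : numClosedFieldType) n (A : 'M[C]_n) : Prop :=
  A \is hermsymmx /\ forall v : 'cV[C]_n, 0 <= (v^t* *m A *m v) 0 0.

(* Functional calculus: with A = P^-1 diag(d) P, P unitary, take
   P^-1 diag(sqrt d) P.  The value is meaningful for A positive semidefinite,
   where it is the unique positive semidefinite square root of A (sqrtmx_psd,
   sqrtmxK, psdmx_sqr_inj). *)
Definition sqrtmx (C : numClosedFieldType) n (A : 'M[C]_n) : 'M[C]_n :=
  invmx (spectralmx A) *m diag_mx (map_mx sqrtC (spectral_diag A))
    *m spectralmx A.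

Definition absmx (C : numClosedFieldType) n (X : 'M[C]_n) : 'M[C]_n :=
  sqrtmx (X^t* *m X).

(* The roots of the characteristic polynomial, listed with multiplicity. *)
Definition eigenvalues (C : numClosedFieldType) n (A : 'M[C]_n) : seq C :=
  sval (closed_field_poly_normal (char_poly A)).

(* The eigenvalues of a Hermitian matrix are real, so taking real parts only
   changes their type (lambda_up_eigenvalues).  Indices start at 0:
   lambda_up H j is the (j+1)-st smallest eigenvalue of H. *)
Definition lambda_up (R : realType) n (H : 'M[R[i]]_n) (j : nat) : R :=
  nth 0 (sort <=%R [seq complex.Re z | z <- eigenvalues H]) j.

Section Facts.
Variable C : numClosedFieldType.

Lemma trmxC_mul m n p (A : 'M[C]_(m, n)) (B : 'M[C]_(n, p)) :
  (A *m B)^t* = B^t* *m A^t*.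
Proof. by rewrite trmx_mul map_mxM. Qed.

Lemma hermsymmxP n (A : 'M[C]_n) : reflect (A^t* = A) (A \is hermsymmx).
Proof.
apply: (iffP idP) => [/is_hermitianmxP|] h.
  by rewrite [RHS]h expr0 scale1r.
by apply/is_hermitianmxP; rewrite expr0 scale1r [RHS]h.
Qed.

Lemma psdmx_gram m n (X : 'M[C]_(m, n)) : psdmx (X^t* *m X).
Proof.
split=> [|v]; first by apply/hermsymmxP; rewrite trmxC_mul trmxCK.
rewrite mulmxA -trmxC_mul -mulmxA mxE sumr_ge0 // => i _.
by rewrite !mxE mulrC mul_conjC_ge0.
Qed.

Lemma psdmx_spectral n (A : 'M[C]_n) (P := spectralmx A) : psdmx A ->
  A = P^t* *m diag_mx (spectral_diag A) *m P
  /\ forall i, 0 <= spectral_diag A 0 i.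
Proof.
move=> [hA pA]; have uP : P \is unitarymx by exact: spectral_unitarymx.
have eA : A = P^t* *m diag_mx (spectral_diag A) *m P.
  by rewrite -invmx_unitary //; apply/orthomx_spectralP/hermitian_normalmx.
split=> // i; move: (spectral_diag A) eA => d eA.
have := pA (P^t* *m delta_mx i 0).
rewrite trmxC_mul trmxCK eA !mulmxA mulmxtVK // -!mulmxA.
rewrite (mulmxA P) (unitarymxP uP) mul1mx trmx_delta map_delta_mx -rowE.
by rewrite mxE mul_diag_mx !mxE !eqxx mulr1.
Qed.

Lemma psdmx_diag n (P : 'M[C]_n) (d : 'rV[C]_n) :
  (forall i, 0 <= d 0 i) -> psdmx (P^t* *m diag_mx d *m P).
Proof.
move=> d_ge0; pose s := map_mx sqrtC d.
have -> : P^t* *m diag_mx d *m P = (diag_mx s *m P)^t* *m (diag_mx s *m P).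
  rewrite trmxC_mul tr_diag_mx map_diag_mx !mulmxA; congr (_ *m _).
  rewrite -!mulmxA; congr (_ *m _); rewrite mulmx_diag; congr diag_mx.
  apply/rowP=> i; rewrite !mxE /= geC0_conj ?sqrtC_ge0 //.
  by rewrite -expr2 sqrtCK.
exact: psdmx_gram.
Qed.

Lemma sqrtmx_psd n (A : 'M[C]_n) : psdmx A -> psdmx (sqrtmx A).
Proof.
move=> /psdmx_spectral[_ d_ge0].
rewrite /sqrtmx invmx_unitary ?spectral_unitarymx //.
by apply: psdmx_diag => i; rewrite mxE sqrtC_ge0.
Qed.

Lemma sqrtmxK n (A : 'M[C]_n) : psdmx A -> sqrtmx A *m sqrtmx A = A.
Proof.
move=> /psdmx_spectral[eA _]; rewrite [RHS]eA /sqrtmx.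
have uP := spectral_unitarymx A.
rewrite invmx_unitary // !mulmxA mulmxtVK //; congr (_ *m _).
rewrite -!mulmxA; congr (_ *m _); rewrite mulmx_diag; congr diag_mx.
by apply/rowP=> i; rewrite !mxE -expr2 sqrtCK.
Qed.

Lemma psdmx_sqr_inj n (S T : 'M[C]_n) :
  psdmx S -> psdmx T -> S *m S = T *m T -> S = T.
Proof.
move=> /psdmx_spectral[eS dS] /psdmx_spectral[eT dT].
move: (spectralmx S) (spectral_unitarymx S) (spectral_diag S) eS dS => P uP d.
move: (spectralmx T) (spectral_unitarymx T) (spectral_diag T) eT dT => Q uQ e.
move=> -> e_ge0 -> d_ge0; rewrite !mulmxA !mulmxtVK // => eq2.
pose U := P *m Q^t*.
have eU : diag_mx d *m diag_mx d *m U = U *m (diag_mx e *m diag_mx e).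
  have := congr1 (fun M => P *m M *m Q^t*) eq2.
  rewrite /U !mulmxA (unitarymxP uP) mul1mx => ->.
  by rewrite mulmxtVK.
have eU1 : diag_mx d *m U = U *m diag_mx e.
  clearbody U; move: eU; rewrite !mulmx_diag => /matrixP eU; apply/matrixP=> i j.
  have := eU i j; rewrite !mul_diag_mx !mul_mx_diag !mxE.
  have [->|u0] := eqVneq (U i j) 0; first by rewrite !mulr0 !mul0r.
  rewrite [LHS]mulrC => /(mulfI u0) /eqP; rewrite -!expr2.
  by rewrite eqrXn2 // => /eqP ->; rewrite mulrC.
have := congr1 (fun M => P^t* *m M *m Q) eU1.
rewrite /U -!mulmxA.
have kQ : Q^t* *m Q = 1%:M by rewrite -invmx_unitary // mulVmx // unitarymx_unit.
have kP : P^t* *m P = 1%:M by rewrite -invmx_unitary // mulVmx // unitarymx_unit.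
by rewrite kQ mulmx1 => ->; rewrite !mulmxA kP mul1mx.
Qed.

Lemma char_poly_eigenvalues n (A : 'M[C]_n) :
  char_poly A = \prod_(z <- eigenvalues A) ('X - z%:P).
Proof.
rewrite /eigenvalues; case: closed_field_poly_normal => r /= {1}->.
by rewrite (monicP (char_poly_monic A)) scale1r.
Qed.

Lemma size_eigenvalues n (A : 'M[C]_n) : size (eigenvalues A) = n.
Proof.
have := size_char_poly A; rewrite char_poly_eigenvalues.
by rewrite size_prod_XsubC => -[].
Qed.

Lemma hermsymmx_eigenvalues_real n (A : 'M[C]_n) :
  A \is hermsymmx -> {in eigenvalues A, forall z, z \is Num.real}.
Proof.
move=> hA z; rewrite -root_prod_XsubC -char_poly_eigenvalues.
rewrite -eigenvalue_root_char => /eigenvalueP[v vA v0].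
have eq_vv : z *: (v *m v^t*) = z^* *: (v *m v^t*).
  rewrite scalemxAl -vA -{1}(hermsymmxP _ hA) -mulmxA -trmxC_mul vA.
  by rewrite linearZ /= map_mxZ -scalemxAr.
have vv0 : (v *m v^t*) 0 0 != 0 by rewrite -dotmxE dnorm_eq0.
apply/CrealP; move/matrixP: eq_vv => /(_ 0 0); rewrite !mxE /=.
by move=> h; apply/esym/(mulIf vv0); rewrite mxE.
Qed.

End Facts.

Lemma lambda_up_eigenvalues (R : realType) n (H : 'M[R[i]]_n) :
  H \is hermsymmx ->
  perm_eq [seq (lambda_up H j)%:C | j <- iota 0 n] (eigenvalues H).
Proof.
move=> hH; pose r := [seq complex.Re z | z <- eigenvalues H].
have szr : size (sort <=%R r) = n.
  by rewrite size_sort size_map size_eigenvalues.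
have -> : [seq (lambda_up H j)%:C | j <- iota 0 n] =
          [seq x%:C | x <- sort <=%R r].
  by rewrite -[in RHS](mkseq_nth 0 (sort <=%R r)) szr /mkseq -map_comp.
apply: perm_trans (_ : perm_eq [seq x%:C | x <- r] _).
  by apply: perm_map; rewrite perm_sort.
rewrite /r -map_comp map_id_in // => z /(hermsymmx_eigenvalues_real hH) zr.
by rewrite /= RRe_real.
Qed.

Lemma lambda_up_nondecreasing (R : realType) n (H : 'M[R[i]]_n) (i j : nat) :
  (i <= j < n)%N -> lambda_up H i <= lambda_up H j.
Proof.
move=> /andP[leij ltjn]; rewrite /lambda_up.
apply: le_sorted_leq_nth => //; first exact: sort_le_sorted.
  by rewrite inE size_sort size_map size_eigenvalues (leq_ltn_trans leij).
by rewrite inE size_sort size_map size_eigenvalues.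
Qed.

(* Main.v *)
(** Write [p_k(M)] for the product of the [k] smallest eigenvalues of [M].  By
    Cauchy-Binet, [p_k(M) det(Y Y^* ) <= det(Y M Y^* )] for [M] positive
    semidefinite and any [k x n] matrix [Y], with equality when the rows of [Y]
    are eigenvectors for the [k] smallest eigenvalues.

    If [A] is singular, the left-hand side is [0].  Otherwise let
    [S = sqrt A] and [N = S B S].
    - [A B S = S N], so testing [|A B|^2] on the images under [S] of the
      eigenvectors of [N] gives [p_k(sqrt |A B|)^2 <= p_k(N)].
    - Let the rows of [V] be eigenvectors of [H = (A + B) / 2] for its [k]
      smallest eigenvalues.  Testing [N] on [W = V S^-1] gives
      [p_k(N) det(W W^* ) <= det(V B V^* )], and Cauchy-Schwarz gives
      [1 <= det(V A V^* ) det(W W^* )].  Hence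
      [p_k(N) <= det(V A V^* ) det(V B V^* ) <= det(V H V^* )^2 = p_k(H)^2],
      the middle step being the arithmetic-geometric mean inequality for
      determinants. *)

Require Import Defs.
From mathcomp Require Import all_boot all_order all_algebra.
From mathcomp Require Import all_fingroup.
From mathcomp Require Import ring.
From mathcomp Require Import sesquilinear spectral complex reals.

Set Implicit Arguments.
Unset Strict Implicit.
Unset Printing Implicit Defensive.

Import Order.TTheory GRing.Theory Num.Theory.
Local Open Scope ring_scope.
Local Open Scope sesquilinear_scope.

(** * Cauchy-Binet expansions indexed by maps *)

Lemma det_mulmx_ffun (R : comNzRingType) k n
    (X : 'M[R]_(k, n)) (Y : 'M[R]_(n, k)) :
  \det (X *m Y) =
  \sum_(f : {ffun 'I_k -> 'I_n}) (\prod_i X i (f i)) * \det (rowsub f Y).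
Proof.
under [RHS]eq_bigr => f _ do rewrite [\det _]/determinant big_distrr /=.
rewrite exchange_big; apply: eq_bigr => s _ /=.
under eq_bigr => i _ do rewrite mxE.
rewrite (bigA_distr_bigA (fun i j => X i j * Y j (s i))) big_distrr /=.
apply: eq_bigr => f _; rewrite big_split /= mulrCA; congr (_ * (_ * _)).
by apply: eq_bigr => i _; rewrite mxE.
Qed.

(* Summing over all maps [f], rather than over the [k]-subsets of [1..n],
   counts every subset [k`!] times; non-injective maps contribute [0]. *)
Lemma Cauchy_Binet_ffun (R : comNzRingType) k n
    (X : 'M[R]_(k, n)) (Y : 'M[R]_(n, k)) :
  \det (X *m Y) *+ k`! =
  \sum_(f : {ffun 'I_k -> 'I_n}) \det (colsub f X) * \det (rowsub f Y).
Proof.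
under [RHS]eq_bigr => f _.
  rewrite -(det_tr (colsub f X)) [\det _^T]/determinant big_distrl /=.
  under eq_bigr => s _ do (under eq_bigr => i _ do rewrite !mxE).
  over.
rewrite exchange_big /= -card_Sn -sumr_const.
apply: eq_big => s; first by rewrite inE.
move=> _; rewrite det_mulmx_ffun.
pose h (t : 'S_k) (f : {ffun 'I_k -> 'I_n}) := [ffun i => f (t i)].
have hK t : cancel (h t) (h t^-1%g).
  by move=> f; apply/ffunP=> i; rewrite !ffunE permKV.
(* Precomposing [f] with [s] permutes the rows taken from [Y]; the resulting sign cancels the one
   already present, so every [s] contributes the same [\det (X *m Y)]. *)
rewrite [RHS](reindex_inj (can_inj (hK s))) /=.
apply: eq_bigr => f _.
have -> : rowsub (h s f) Y = row_perm s (rowsub f Y).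
  by apply/matrixP=> i j; rewrite !mxE ffunE.
rewrite row_permE det_mulmx det_perm mulrACA -signr_addb addbb mul1r.
under [in RHS]eq_bigr => i _ do rewrite ffunE.
by rewrite [in LHS](reindex_perm s).
Qed.

(** * Gram determinants and positive semidefinite matrices *)

Section Gram.
Variable C : numClosedFieldType.

Lemma det_trmxC n (M : 'M[C]_n) : \det (M^t*) = (\det M)^*.
Proof. by rewrite det_map_mx det_tr. Qed.

Lemma det_gram_diag k n (Y : 'M[C]_(k, n)) (d : 'rV[C]_n) :
  \det (Y *m diag_mx d *m Y^t*) *+ k`! =
  \sum_(f : {ffun 'I_k -> 'I_n})
     (\prod_i d 0 (f i)) * `|\det (colsub f Y)| ^+ 2.
Proof.
rewrite Cauchy_Binet_ffun; apply: eq_bigr => f _.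
have -> : colsub f (Y *m diag_mx d) = colsub f Y *m diag_mx (colsub f d).
  by rewrite !mul_mx_diag; apply/matrixP=> i j; rewrite !mxE.
have -> : rowsub f (Y^t*) = (colsub f Y)^t*.
  by apply/matrixP=> i j; rewrite !mxE.
rewrite det_mulmx det_diag det_trmxC normCK mulrAC mulrC; congr (_ * _).
by apply: eq_bigr => i _; rewrite mxE.
Qed.

(** Both sides expand over the same squared minors of [Y], so the weights can be compared term by
    term; a non-injective [f] repeats a column and its minor vanishes. *)
Lemma det_gram_diag_ge k n (Y : 'M[C]_(k, n)) (d : 'rV[C]_n) (c : C) :
  (forall f : {ffun 'I_k -> 'I_n}, injective f -> c <= \prod_i d 0 (f i)) ->
  c * \det (Y *m Y^t*) <= \det (Y *m diag_mx d *m Y^t*).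
Proof.
move=> cd; rewrite -(ler_pMn2r (fact_gt0 k)) det_gram_diag -mulrnAr.
have -> : Y *m Y^t* = Y *m diag_mx (const_mx 1) *m Y^t*.
  by rewrite diag_const_mx mulmx1.
rewrite det_gram_diag big_distrr /=; apply: ler_sum => f _.
rewrite big1 ?mul1r => [|i _]; last by rewrite mxE.
have [/injectiveP finj|/injectivePn[i [j ij fij]]] := boolP (injectiveb f).
  by rewrite ler_wpM2r ?exprn_ge0 // cd.
rewrite -det_tr (determinant_alternate ij) ?normr0 ?expr0n ?mulr0 //= => l.
by rewrite !mxE fij.
Qed.

Lemma psdmx_det_ge0 n (M : 'M[C]_n) : psdmx M -> 0 <= \det M.
Proof.
move=> /psdmx_spectral[eM d_ge0].
rewrite eM !det_mulmx det_trmxC det_diag mulrAC -normCKC.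
by rewrite mulr_ge0 ?exprn_ge0 //; apply: prodr_ge0.
Qed.

Lemma psdmx_congr m n (M : 'M[C]_n) (Y : 'M[C]_(m, n)) :
  psdmx M -> psdmx (Y *m M *m Y^t*).
Proof.
move=> pM; have [/hermsymmxP] := sqrtmx_psd pM.
have := sqrtmxK pM; move: (sqrtmx M) => S <- hS _.
have -> : Y *m (S *m S) *m Y^t* = (S *m Y^t*)^t* *m (S *m Y^t*).
  by rewrite trmxC_mul trmxCK hS !mulmxA.
exact: psdmx_gram.
Qed.

(** The ordinary Cauchy-Schwarz inequality for the vectors of maximal minors, whose inner products
    are these determinants up to a common factor by Cauchy-Binet. *)
Lemma det_gram_CauchySchwarz k n (X Y : 'M[C]_(k, n)) :
  `|\det (X *m Y^t*)| ^+ 2 <= \det (X *m X^t*) * \det (Y *m Y^t*).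
Proof.
pose v (Z : 'M[C]_(k, n)) : 'rV[C]_#|{ffun 'I_k -> 'I_n}| :=
  \row_i \det (colsub (enum_val i : {ffun 'I_k -> 'I_n}) Z).
have dv (Z T : 'M[C]_(k, n)) : dotmx (v Z) (v T) = \det (Z *m T^t*) *+ k`!.
  rewrite dotmxE Cauchy_Binet_ffun mxE.
  rewrite [RHS](reindex _ (onW_bij _ (@enum_val_bij _))) /=.
  apply: eq_bigr => i _; rewrite !mxE -det_trmxC; congr (_ * \det _).
  by apply/matrixP=> a b; rewrite !mxE.
have : `|dotmx (v X) (v Y)| ^+ 2 <= dotmx (v X) (v X) * dotmx (v Y) (v Y).
  by case: (CauchySchwarz (@dotmx C _) (v X) (v Y)).
rewrite !dv normrMn exprMn_n mulrnAr mulrnAl -mulrnA -mulnn.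
by rewrite ler_pMn2r // muln_gt0 fact_gt0.
Qed.

Lemma psdmxD n (M N : 'M[C]_n) : psdmx M -> psdmx N -> psdmx (M + N).
Proof.
move=> [/hermsymmxP hM pM] [/hermsymmxP hN pN]; split=> [|v].
  by apply/hermsymmxP; rewrite linearD map_mxD hM hN.
by rewrite mulmxDr mulmxDl mxE addr_ge0.
Qed.

Lemma psdmxZ n (a : C) (M : 'M[C]_n) : 0 <= a -> psdmx M -> psdmx (a *: M).
Proof.
move=> a0 [/hermsymmxP hM pM]; split=> [|v].
  by apply/hermsymmxP; rewrite linearZ map_mxZ /= geC0_conj ?hM.
by rewrite -scalemxAr -scalemxAl mxE mulr_ge0.
Qed.

Lemma psdmx_mean n (M N : 'M[C]_n) :
  psdmx M -> psdmx N -> psdmx (2^-1 *: (M + N)).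
Proof.
by move=> pM pN; apply: psdmxZ (psdmxD pM pN); rewrite invr_ge0 ler0n.
Qed.

Lemma det_conj_unitary n (U M : 'M[C]_n) :
  U \is unitarymx -> \det (U^t* *m M *m U) = \det M.
Proof.
move=> /unitarymxP uU; rewrite !det_mulmx mulrAC -det_mulmx.
by rewrite mulmx1C // det1 mul1r.
Qed.

(** In an eigenbasis of [T] this is [x <= ((1 + x) / 2)^2] for each eigenvalue. *)
Lemma psdmx_det_half1D n (T : 'M[C]_n) : psdmx T ->
  \det T <= \det (2^-1 *: (1%:M + T)) ^+ 2.
Proof.
move=> /psdmx_spectral[eT d_ge0]; have uU := spectral_unitarymx T.
move: (spectralmx T) uU (spectral_diag T) eT d_ge0 => U uU d -> d_ge0.
have -> : 2^-1 *: (1%:M + U^t* *m diag_mx d *m U) =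
          U^t* *m diag_mx (2^-1 *: (const_mx 1 + d)) *m U.
  rewrite [in RHS]linearZ [in RHS]linearD /= diag_const_mx.
  rewrite -scalemxAr -scalemxAl mulmxDr mulmx1 mulmxDl; congr (_ *: (_ + _)).
  by rewrite mulmx1C //; apply/unitarymxP.
rewrite !det_conj_unitary // !det_diag -prodrXl; apply: ler_prod => i _.
rewrite d_ge0 !mxE /=; have := d_ge0 i; move: (d 0 i) => x x0.
rewrite exprMn -subr_ge0.
have -> : 2^-1 ^+ 2 * (1 + x) ^+ 2 - x = (2^-1 * (1 - x)) ^+ 2.
  by field.
by rewrite real_exprn_even_ge0 // realM ?realB ?ger0_real ?invr_ge0.
Qed.

(** For invertible [P], congruence by the inverse of [sqrtmx P] reduces to the case where [P] is the
    identity. *)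
Lemma psdmx_det_mean n (P Q : 'M[C]_n) : psdmx P -> psdmx Q ->
  \det P * \det Q <= \det (2^-1 *: (P + Q)) ^+ 2.
Proof.
move=> pP pQ.
have [P0|P0] := eqVneq (\det P) 0.
  rewrite P0 mul0r exprn_ge0 ?psdmx_det_ge0 //; exact: psdmx_mean.
have [/hermsymmxP + _] := sqrtmx_psd pP.
have := sqrtmxK pP; move: (sqrtmx P) => S SS hS.
have uS : S \in unitmx.
  apply: contra_neqT P0; rewrite -SS det_mulmx unitmxE unitfE negbK => /eqP->.
  by rewrite mul0r.
have [T pT eQ] : exists2 T, psdmx T & Q = S *m T *m S.
  exists (invmx S *m Q *m (invmx S)^t*); first exact: psdmx_congr.
  by rewrite trmx_inv map_invmx hS !mulmxA mulmxV // mul1mx mulmxKV.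
have -> : 2^-1 *: (P + Q) = S *m (2^-1 *: (1%:M + T)) *m S.
  by rewrite -scalemxAr -scalemxAl mulmxDr mulmxDl mulmx1 SS -eQ.
have dS : 0 <= \det S ^+ 2 by rewrite expr2 -det_mulmx SS psdmx_det_ge0.
rewrite eQ -SS !det_mulmx.
have -> : \det S * \det S * (\det S * \det T * \det S) =
          (\det S ^+ 2) ^+ 2 * \det T by ring.
rewrite [X in _ <= X ^+ 2]mulrAC -expr2 [leRHS]exprMn.
by rewrite ler_wpM2l ?(exprn_ge0 2 dS) ?psdmx_det_half1D.
Qed.
End Gram.

(** * Powers, square roots and unitary diagonalisation *)

Lemma sqrtmx_sqr (C : numClosedFieldType) n (P : 'M[C]_n) :
  psdmx P -> sqrtmx P ^+ 2 = P.
Proof. by move=> /sqrtmxK eP; rewrite expr2 -mulmxE. Qed.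

Lemma unitmxX (F : fieldType) n (M : 'M[F]_n) m :
  M \in unitmx -> M ^+ m \in unitmx.
Proof.
move=> uM; elim: m => [|m IHm]; first by rewrite expr0 unitmx1.
by rewrite exprS -mulmxE unitmx_mul uM.
Qed.

Lemma sqrtmx_unit (C : numClosedFieldType) n (P : 'M[C]_n) :
  psdmx P -> P \in unitmx -> sqrtmx P \in unitmx.
Proof. by move=> /sqrtmxK eP; rewrite -{1}eP unitmx_mul => /andP[]. Qed.

Lemma conj_unitaryX (C : numClosedFieldType) n (U : 'M[C]_n) (d : 'rV[C]_n) m :
  U \is unitarymx ->
  (U^t* *m diag_mx d *m U) ^+ m = U^t* *m diag_mx (\row_j (d 0 j ^+ m)) *m U.
Proof.
move=> uU; elim: m => [|m IHm].
  have -> : \row_j d 0 j ^+ 0 = const_mx 1.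
    by apply/rowP=> j; rewrite !mxE expr0.
  by rewrite expr0 diag_const_mx mulmx1 mulmx1C //; apply/unitarymxP.
rewrite exprS {}IHm -mulmxE.
have -> : diag_mx (\row_j (d 0 j ^+ m.+1)) =
          diag_mx d *m diag_mx (\row_j (d 0 j ^+ m)).
  by rewrite mulmx_diag; congr diag_mx; apply/rowP=> j; rewrite !mxE exprS.
by move: (diag_mx d) (diag_mx _) => D E; rewrite !mulmxA mulmxtVK.
Qed.

Lemma perm_eigenvalues_unitary (C : numClosedFieldType) n
    (U : 'M[C]_n) (d : 'rV[C]_n) :
  U \is unitarymx ->
  perm_eq (eigenvalues (U^t* *m diag_mx d *m U)) [seq d 0 i | i <- enum 'I_n].
Proof.
move=> /unitarymxP uU; apply: prod_XsubC_eq; rewrite -char_poly_eigenvalues.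
pose V := map_mx polyC U; pose V' := map_mx polyC (U^t*).
have V'V : V' *m V = 1%:M.
  by rewrite -map_mxM mulmx1C // map_mx1.
rewrite /char_poly.
have -> : char_poly_mx (U^t* *m diag_mx d *m U) =
          V' *m char_poly_mx (diag_mx d) *m V.
  rewrite /char_poly_mx !map_mxM mulmxBr mulmxBl; congr (_ - _).
  by rewrite -scalemx1 -scalemxAr -scalemxAl mulmx1 V'V.
rewrite !det_mulmx mulrAC -det_mulmx V'V det1 mul1r.
have := @char_poly_trig _ _ (diag_mx d) (diag_mx_is_trig d).
rewrite /char_poly => ->; rewrite big_map big_enum /=.
by apply: eq_bigr => i _; rewrite mxE eqxx.
Qed.

(** * Eigenvalues in increasing order *)

Section Lambda.
Variables (R : realType) (n : nat).
Implicit Types M : 'M[R[i]]_n.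

(** Permuting the rows of the diagonalising unitary matrix sorts the eigenvalues, so its first rows
    belong to the smallest ones. *)
Lemma lambda_up_spectral M : M \is hermsymmx ->
  exists2 U : 'M_n, U \is unitarymx &
    M = U^t* *m diag_mx (\row_j (lambda_up M j)%:C%C) *m U.
Proof.
move=> hM; have := lambda_up_eigenvalues hM.
have /orthomx_spectralP eM := hermitian_normalmx hM.
have uP := spectral_unitarymx M; rewrite invmx_unitary // in eM.
move: (spectralmx M) (spectral_diag M) uP eM => P d uP eM.
rewrite {2}eM => /perm_trans/(_ (perm_eigenvalues_unitary d uP)).
have -> : [seq d 0 i | i <- enum 'I_n] = [tuple d 0 i | i < n] by [].
case/tuple_permP => s es.
have {}es (i : 'I_n) : (lambda_up M i)%:C%C = d 0 (s i).
  have := congr1 (nth 0 ^~ i) es.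
  rewrite (nth_map 0%N) ?size_iota // nth_iota // add0n => ->.
  by rewrite -tnth_nth !tnth_mktuple.
exists (row_perm s P).
  rewrite row_permE mul_unitarymx //; apply/unitarymxP.
  by rewrite tr_perm_mx map_perm_mx -perm_mxM mulgV perm_mx1.
rewrite [LHS]eM; apply/matrixP=> a b.
rewrite !mul_mx_diag !mxE (reindex_perm s); apply: eq_bigr => j _.
by rewrite !mxE es.
Qed.

Lemma lambda_up_ge0 M j : psdmx M -> 0 <= lambda_up M j.
Proof.
(* Beyond the last eigenvalue [lambda_up] takes the default value [0]. *)
move=> pM; have [jn|nj] := ltnP j n; last first.
  by rewrite /lambda_up nth_default // size_sort size_map size_eigenvalues.
have [eM d_ge0] := psdmx_spectral pM.
have /perm_mem e1 := lambda_up_eigenvalues (proj1 pM).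
have /perm_mem e2 :=
  perm_eigenvalues_unitary (spectral_diag M) (spectral_unitarymx M).
have : (lambda_up M j)%:C%C \in eigenvalues M.
  by rewrite -e1; apply/mapP; exists j; rewrite ?mem_iota.
rewrite eM e2 => /mapP[i _ /esym ei].
by rewrite -lecR -eM in ei *; rewrite -ei d_ge0.
Qed.

End Lambda.

Lemma prod_first_le (R : realDomainType) n (d : nat -> R) k (f : 'I_k -> 'I_n) :
  (forall i, 0 <= d i) -> (forall i j, (i <= j < n)%N -> d i <= d j) ->
  injective f -> \prod_(0 <= j < k) d j <= \prod_i d (f i).
Proof.
move=> d0 dle; elim: k f => [|k IHk] f fI; first by rewrite big_nil big_ord0.
(* Pigeonhole: [f] cannot inject [k + 1] indices into [k] values. The factor at [i] dominates [d k],
   and induction handles the others. *)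
have [i ki] : exists i, (k <= f i)%N.
  apply/existsP; apply: contraT; rewrite negb_exists => /forallP fk.
  have {}fk i : (f i < k)%N by rewrite ltnNge fk.
  suff /leq_card : injective (fun i => Ordinal (fk i)).
    by rewrite !card_ord ltnn.
  by move=> i j [] /val_inj/fI.
rewrite big_nat_recr //= (bigD1_ord i) //= mulrC ler_pM ?prodr_ge0 //.
  by rewrite dle // ki ltn_ord.
by apply: (IHk (f \o lift i)); apply: inj_comp => //; apply: lift_inj.
Qed.

(** * The products [p_k] and their extremal property *)

Section ProdLambda.
Variables (R : realType) (n : nat).
Implicit Types M : 'M[R[i]]_n.

Definition prod_lambda M k : R := \prod_(0 <= j < k) lambda_up M j.

Lemma prod_lambda_ge0 M k : psdmx M -> 0 <= prod_lambda M k.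
Proof. by move=> pM; apply: prodr_ge0 => j _; apply: lambda_up_ge0. Qed.

Lemma det_prod_lambda M : M \is hermsymmx -> \det M = (prod_lambda M n)%:C%C.
Proof.
move=> /lambda_up_spectral[U uU eM]; rewrite {1}eM det_conj_unitary // det_diag.
rewrite /prod_lambda big_mkord rmorph_prod.
by apply: eq_bigr => j _; rewrite mxE.
Qed.

(** Diagonalising [M] reduces this to [det_gram_diag_ge]. The exponent serves the case [m = 4],
    where the power of [sqrt |A B|] becomes a polynomial in [A] and [B]. *)
Lemma prod_lambdaX_le M k m (Y : 'M[R[i]]_(k, n)) : psdmx M ->
  (prod_lambda M k ^+ m)%:C%C * \det (Y *m Y^t*) <=
  \det (Y *m (M ^+ m) *m Y^t*).
Proof.
move=> pM; have [U uU eM] := lambda_up_spectral (proj1 pM).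
rewrite {2}eM conj_unitaryX //.
set d := \row_j (_ ^+ m).
have -> : Y *m Y^t* = (Y *m U^t*) *m (Y *m U^t*)^t*.
  by rewrite trmxC_mul trmxCK mulmxA mulmxKtV.
have -> : Y *m (U^t* *m diag_mx d *m U) *m Y^t* =
          (Y *m U^t*) *m diag_mx d *m (Y *m U^t*)^t*.
  by rewrite trmxC_mul trmxCK !mulmxA.
apply: det_gram_diag_ge => f fI.
have -> : \prod_i d 0 (f i) = ((\prod_i lambda_up M (f i)) ^+ m)%:C%C.
  rewrite rmorphXn rmorph_prod -prodrXl; apply: eq_bigr => i _.
  by rewrite !mxE.
have l0 j := lambda_up_ge0 j pM.
rewrite lecR lerXn2r ?nnegrE ?prodr_ge0 // prod_first_le // => i j.
exact: lambda_up_nondecreasing.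
Qed.

Lemma prod_lambda_le M k (Y : 'M[R[i]]_(k, n)) : psdmx M ->
  (prod_lambda M k)%:C%C * \det (Y *m Y^t*) <= \det (Y *m M *m Y^t*).
Proof. by move=> /(prod_lambdaX_le 1 Y); rewrite !expr1. Qed.

(** Supplies orthonormal test rows that attain equality in [prod_lambda_le]. *)
Lemma prod_lambda_frame M k : M \is hermsymmx -> (k <= n)%N ->
  exists Z : 'M[R[i]]_(k, n), exists D : 'M[R[i]]_k,
  [/\ Z *m Z^t* = 1%:M, Z *m M = D *m Z & \det D = (prod_lambda M k)%:C%C].
Proof.
move=> hM kn; have [U uU eM] := lambda_up_spectral hM.
exists (rowsub (widen_ord kn) U).
exists (diag_mx (\row_j (lambda_up M j)%:C%C)); split.
- have -> : (rowsub (widen_ord kn) U)^t* = colsub (widen_ord kn) (U^t*).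
    by apply/matrixP=> i j; rewrite !mxE.
  rewrite -mxsub_mul (unitarymxP uU); apply/matrixP=> i j; rewrite !mxE.
  by rewrite -val_eqE.
- rewrite mul_rowsub_mx {1}eM !mulmxA (unitarymxP uU) mul1mx.
  by rewrite !mul_diag_mx; apply/matrixP=> i j; rewrite !mxE.
- rewrite det_diag /prod_lambda big_mkord rmorph_prod.
  by apply: eq_bigr => j _; rewrite mxE.
Qed.

End ProdLambda.

(** * Comparison of both sides through [S B S] *)

Section Main.
Variables (R : realType) (n : nat).
Implicit Types A B : 'M[R[i]]_n.

Lemma sqrtmx_absmx_exp4 A B : psdmx A -> psdmx B ->
  sqrtmx (absmx (A *m B)) ^+ 4 = B *m A *m (A *m B).
Proof.
move=> [/hermsymmxP hA _] [/hermsymmxP hB _].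
have pX := psdmx_gram (A *m B).
have eY := sqrtmx_sqr pX; have eT := sqrtmx_sqr (sqrtmx_psd pX).
rewrite -/(absmx (A *m B)) in eY eT.
rewrite (exprM _ 2 2) eT eY.
by rewrite trmxC_mul hA hB.
Qed.

(** A vanishing determinant forces some eigenvalue to be [0]; by order and nonnegativity the
    smallest one is then [0]. *)
Lemma prod_lambda_singular A k : psdmx A -> A \notin unitmx -> (0 < k)%N ->
  prod_lambda A k = 0.
Proof.
move=> pA; rewrite unitmxE unitfE negbK det_prod_lambda ?(proj1 pA) // => + k0.
rewrite -[0]/(0%:C%C) (inj_eq (@complexI R)) /prod_lambda big_mkord.
case/prodf_eq0 => /= i _ /eqP li.
rewrite big_ltn //; suff -> : lambda_up A 0 = 0 by rewrite mul0r.
apply/eqP; rewrite eq_le lambda_up_ge0 // andbT -li.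
by rewrite lambda_up_nondecreasing //=.
Qed.

(* A case of Weyl's inequality between singular values and eigenvalues: [A *m B]
   is similar to [S *m B *m S]. *)
Lemma prod_lambda_sqrt_abs_le A B k (S := sqrtmx A) : psdmx A -> psdmx B ->
  A \in unitmx -> (k <= n)%N ->
  prod_lambda (sqrtmx (absmx (A *m B))) k ^+ 2 <= prod_lambda (S *m B *m S) k.
Proof.
move=> pA pB uA kn.
have [/hermsymmxP hA _] := pA; have [/hermsymmxP hB _] := pB.
have [/hermsymmxP + _] := sqrtmx_psd pA.
have := sqrtmx_unit pA uA; have := sqrtmxK pA.
rewrite -/S; move: S => S SS uS hS.
have pN : psdmx (S *m B *m S) by rewrite -{2}hS; apply: psdmx_congr.
have [Z [D [ZZ ZN dD]]] := prod_lambda_frame (proj1 pN) kn.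
have pT : psdmx (sqrtmx (absmx (A *m B))).
  by do 2!apply: sqrtmx_psd; apply: psdmx_gram.
pose X := Z *m S.
(* Since [A = S S], [Z S B A = Z (S B S) S = D Z S]. *)
have XBA : X *m (B *m A) = D *m X.
  by rewrite /X -SS !mulmxA -ZN !mulmxA.
have XY : X *m (Z *m invmx S)^t* = 1%:M.
  by rewrite trmxC_mul trmx_inv map_invmx hS mulmxA mulmxK.
clearbody X; have := prod_lambdaX_le 4 X pT.
rewrite sqrtmx_absmx_exp4 //.
have -> : X *m (B *m A *m (A *m B)) *m X^t* = D *m (X *m X^t*) *m D^t*.
  have -> : D *m (X *m X^t*) *m D^t* = (D *m X) *m (D *m X)^t*.
    by rewrite trmxC_mul !mulmxA.
  by rewrite -XBA [in RHS]trmxC_mul [in RHS]trmxC_mul hA hB !mulmxA.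
rewrite !det_mulmx det_trmxC dD mulrAC -mulrC.
have XX0 : 0 <= \det (X *m X^t*).
  by rewrite -[X in X *m _]trmxCK; apply/psdmx_det_ge0/psdmx_gram.
(* Cauchy-Schwarz against [Z S^-1], whose pairing with [X] is the identity, keeps this determinant
   away from [0] so that it can be cancelled. *)
have XXn0 : \det (X *m X^t*) != 0.
  have := det_gram_CauchySchwarz X (Z *m invmx S).
  rewrite XY det1 normr1 expr1n.
  by move=> h; apply: contraTneq h => ->; rewrite mul0r ler10.
rewrite [leLHS]mulrC ler_pM2r ?lt0r ?XXn0 // geC0_conj; last first.
  by rewrite -[0]/(0%:C%C) lecR prod_lambda_ge0.
rewrite -rmorphM lecR.
have := prod_lambda_ge0 k pN; have := prod_lambda_ge0 k pT.
move: (prod_lambda (sqrtmx _) k) (prod_lambda (S *m B *m S) k) => a b a0 b0.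
by rewrite -expr2 (exprM a 2 2) ler_pXn2r // nnegrE sqr_ge0.
Qed.

Lemma prod_lambda_conj_sqrt_le A B k (S := sqrtmx A) : psdmx A -> psdmx B ->
  A \in unitmx -> (k <= n)%N ->
  prod_lambda (S *m B *m S) k <= prod_lambda (2^-1 *: (A + B)) k ^+ 2.
Proof.
move=> pA pB uA kn.
have [/hermsymmxP + _] := sqrtmx_psd pA.
have := sqrtmx_unit pA uA; have := sqrtmxK pA.
rewrite -/S; move: S => S SS uS hS.
have pN : psdmx (S *m B *m S) by rewrite -{2}hS; apply: psdmx_congr.
have pH := psdmx_mean pA pB.
have [V [D [VV VH dD]]] := prod_lambda_frame (proj1 pH) kn.
pose W := V *m invmx S; pose X := V *m S.
have XW : X *m W^t* = 1%:M.
  by rewrite trmxC_mul trmx_inv map_invmx hS mulmxA mulmxK.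
have XX : X *m X^t* = V *m A *m V^t*.
  by rewrite trmxC_mul hS -SS !mulmxA.
have WN : W *m (S *m B *m S) *m W^t* = V *m B *m V^t*.
  by rewrite trmxC_mul trmx_inv map_invmx hS !mulmxA mulmxKV // mulmxK.
have pVA := psdmx_congr V pA; have pVB := psdmx_congr V pB.
have CS := det_gram_CauchySchwarz X W.
rewrite XW det1 normr1 expr1n XX in CS.
have := prod_lambda_le W pN; rewrite WN => NW.
have := psdmx_det_mean pVA pVB.
have -> : 2^-1 *: (V *m A *m V^t* + V *m B *m V^t*) = D.
  rewrite -mulmxDl -mulmxDr scalemxAl scalemxAr VH.
  by rewrite -mulmxA VV mulmx1.
rewrite dD -rmorphXn => AB_H; rewrite -lecR; apply: le_trans AB_H.
(* With [N = S B S], [NW] is multiplied by [det(V A V^* )]; it remains to insert the factor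
   [det(V A V^* ) det(W W^* )], which is at least [1] by [CS]. *)
apply: le_trans (ler_wpM2l (psdmx_det_ge0 pVA) NW).
rewrite mulrCA ler_peMr // -[0]/(0%:C%C) lecR; exact: prod_lambda_ge0.
Qed.

End Main.

Local Open Scope complex_scope.

Theorem theorem4p1 (R : realType) (n : nat) (A B : 'M[R[i]]_n)
    (hA : psdmx A) (hB : psdmx B) (k : nat) (hk : (1 <= k <= n)%N) :
  \prod_(0 <= j < k) lambda_up (sqrtmx (absmx (A *m B))) j
    <= \prod_(0 <= j < k) lambda_up (2^-1 *: (A + B)) j.
Proof.
have [k0 kn] := andP hk.
have pT : psdmx (sqrtmx (absmx (A *m B))).
  by do 2!apply: sqrtmx_psd; apply: psdmx_gram.
have pH := psdmx_mean hA hB.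
change (prod_lambda (sqrtmx (absmx (A *m B))) k
        <= prod_lambda (2^-1 *: (A + B)) k).
have [uA|nA] := boolP (A \in unitmx).
  have le_sqr (a b : R) : 0 <= a -> 0 <= b -> a ^+ 2 <= b ^+ 2 -> a <= b.
    by move=> a0 b0; rewrite ler_pXn2r.
  apply: (le_sqr _ _ (prod_lambda_ge0 k pT) (prod_lambda_ge0 k pH)).
  exact: le_trans (prod_lambda_sqrt_abs_le hA hB uA kn)
                  (prod_lambda_conj_sqrt_le hA hB uA kn).
rewrite prod_lambda_singular //; first exact: prod_lambda_ge0.
(* The fourth power [B A A B] inherits the singularity of [A], so [sqrt |A B|] is singular too. *)
have : sqrtmx (absmx (A *m B)) ^+ 4 \notin unitmx.
  by rewrite sqrtmx_absmx_exp4 // !unitmx_mul (negbTE nA) andbF.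
by apply: contra => uT; apply: unitmxX.
Qed.
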